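(* Let $r$ be a relation instance with $n$ tuples of a relation schema $R = \{A_1,\dots,A_m\}$, let $\gamma$ be the comparison bound, and let $\mathcal{H} = (R, E)$ be a hypergraph used by the DUD procedure: $E$ is the set of inclusion-wise minimal members of a collection $\mathcal{D}$ of difference sets of pairs of tuples of $r$, where $\mathcal{D}$ contains $DS(t_1,t_2)$ for every pair of distinct tuples $t_1,t_2 \in r$ that satisfy $t_1[A] = t_2[A]$ for at least one attribute $A$ of FG type. Let $X$ be a UCC candidate, i.e. a minimal hitting set of $\mathcal{H}$. If $X$ contains an attribute $A_i$ of FG type, then $X$ is a UCC of $r$.
   Context: A relation schema $R=\{A_1,\dots,A_m\}$ is a finite set of attributes; a relation instance $r$ is a finite collection of $n$ tuples, where a tuple $t$ assigns to each $A\in R$ a value $t[A]$. For $X \subseteq R$, $t[X]$ is the projection of $t$ on $X$; $t_1[X]=t_2[X]$ means $t_1[A]=t_2[A]$ for all $A\in X$, and $t_1[X]\neq t_2[X]$ means $t_1[A]\ne t_2[A]$ for some $A\in X$. Whenever $t_1,t_2\in r$ are written with different subscripts they denote two distinct tuples of $r$. An attribute set $X\subseteq R$ is a UCC (unique column combination) of $r$ if $t_1[X]\neq t_2[X]$ for all distinct $t_1,t_2\in r$. The difference set of two tuples is $DS(t_1,t_2)=\{A\in R : t_1[A]\neq t_2[A]\}$. For each attribute $A_i$, $cmp_i=\sum_{v}\binom{n_{i,v}}{2}$, where $v$ ranges over the distinct values of $A_i$ in $r$ and $n_{i,v}$ is the number of tuples $t\in r$ with $t[A_i]=v$; that is, $cmp_i$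 is the number of unordered pairs of distinct tuples agreeing on $A_i$. Given a bound $\gamma$ (by default $\gamma = 3n\log_2 n$), $A_i$ is of FG type (''full difference set generation'') if $cmp_i\le\gamma$, and of NG type otherwise. DUD generates the difference sets of all pairs of tuples that agree on at least one attribute of FG type, plus difference sets of some further pairs (from random sampling and from later validation steps); their inclusion-wise minimal members are the hyperedges. A hypergraph is a pair $(V,E)$ with $V$ a finite set and $E$ a set of subsets of $V$. A hitting set is a set $h\subseteq V$ with $h\cap e\neq\emptyset$ for all $e\in E$; it is minimal if it does not properly contain any other hitting set. *)

(* Defs.v *)
From mathcomp Require Import all_boot all_order all_algebra.
From mathcomp Require Import all_reals.

Set Implicit Arguments.
Unset Strict Implicit.
Unset Printing Implicit Defensive.

Import Order.TTheory GRing.Theory Num.Theory.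

Section Relations.
Variables (R : finType) (V : eqType) (n : nat).

(* An instance with n tuples is an indexed family, so that distinct tuples    *)
(* are distinct indices; repeated rows are allowed, and an instance that is a  *)
(* set of tuples is the case where the family is injective.                    *)
Definition instance := 'I_n -> R -> V.

Implicit Types (r : instance) (X : {set R}) (A : R).

Definition ucc r X : Prop :=
  forall i j : 'I_n, i != j -> exists2 A, A \in X & r i A != r j A.

Definition diffset (t1 t2 : R -> V) : {set R} := [set A | t1 A != t2 A].

Definition cmp r A : nat :=
  \sum_(v <- undup (codom (fun i => r i A))) 'C(#|[set i | r i A == v]|, 2).

Definition FG_type (K : realType) (gamma : K) r A : bool :=
  ((cmp r A)%:R <= gamma)%R.

End Relations.

Section Hypergraphs.
Variable V : finType.
Implicit Types (D E : {set {set V}}) (h : {set V}).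

Definition minimal_members D : {set {set V}} := [set e | minset (mem D) e].

Definition hitting_set E h : bool := [forall e in E, h :&: e != set0].

Definition minimal_hitting_set E h : bool := minset (hitting_set E) h.

End Hypergraphs.

(* Main.v *)
(* Tuples that differ on the FG attribute A of X are separated by A. If they    *)
(* agree on A, their difference set lies in D, so it contains a hyperedge; X    *)
(* hits this hyperedge in an attribute on which the tuples differ.              *)
Require Import Defs.
From mathcomp Require Import all_boot all_order all_algebra.
From mathcomp Require Import all_reals.

Theorem theorem4p1 (K : realType) (R : finType) (V : eqType) (n : nat)
    (r : instance R V n) (gamma : K) (D E : {set {set R}})
    (D_diffsets : forall d : {set R}, d \in D ->
       exists i j : 'I_n, i != j /\ d = diffset (r i) (r j))
    (D_FG : forall i j : 'I_n, i != j ->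
       (exists2 A : R, FG_type gamma r A & r i A = r j A) ->
       diffset (r i) (r j) \in D)
    (E_def : E = minimal_members D)
    (X : {set R}) (X_candidate : minimal_hitting_set E X)
    (A : R) (A_in_X : A \in X) (A_FG : FG_type gamma r A) :
  ucc r X.
Proof.
move=> i j neq_ij.
have [eqA|neqA] := eqVneq (r i A) (r j A); last by exists A.
have dD : diffset (r i) (r j) \in D by apply: D_FG => //; exists A.
(* The difference set itself need not be a hyperedge, but as [R] is finite it contains an
   inclusion-minimal member [e] of [D]. *)
have [e min_e /subsetP sub_e] := @minset_exists _ (mem D) _ dD.
(* [X] meets the hyperedge [e] in some [B]; since [e] lies inside the difference set of tuples [i]
   and [j], this [B] witnesses that they differ on [X]. *)
have /forall_inP/(_ e) := minsetp X_candidate.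
rewrite E_def inE => /(_ min_e)/set0Pn[B /setIP[BX /sub_e]].
by rewrite inE => neqB; exists B.
Qed.
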